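(* Let $n\geqslant 5$ be an odd integer. If $n-1$ is not a power of $2$, then the sequence $\mathcal{V}(2,n)$ contains exactly two even terms, namely $2$ and $2n$, and there is an index $m_0$ such that the set of terms $\{a_m : m\geqslant m_0\}$ of $\mathcal{V}(2,n)$ is a union of finitely many (infinite) arithmetic progressions. If $n-1$ is a power of $2$, then $\mathcal{V}(2,n)$ contains (at least) the three even numbers $2$, $2n$ and $2n^2+2$.
   Context: For positive integers $a<b$, the sequence $\mathcal{V}(a,b)=(a_m)_{m\geqslant 1}$ is defined greedily by $a_1=a$, $a_2=b$, and, for $m\geqslant 2$, $a_{m+1}$ is the smallest integer larger than $a_m$ that can be written as $a_i+a_j$ with $i\leqslant j\leqslant m$ (the two earlier terms not necessarily distinct) in exactly one way (representations are unordered pairs). For example $\mathcal{V}(2,3)=2,3,4,5,9,10,11,16,22,\dots$. *)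

(* Defs.v *)
From mathcomp Require Import all_boot.

Set Implicit Arguments.
Unset Strict Implicit.
Unset Printing Implicit Defensive.

(* Number of pairs of positions i <= j in s whose entries add up to x. *)
Definition nreps (s : seq nat) (x : nat) : nat :=
  count (fun p => nth 0 s p.1 + nth 0 s p.2 == x)
        [seq (i, j) | j <- iota 0 (size s), i <- iota 0 j.+1].

(* Smallest x with last 0 s < x that has exactly one representation.  For an
   increasing s the bounded search loses nothing: 2 * last 0 s is represented
   only as (last 0 s) + (last 0 s).  See V_step below. *)
Definition next_term (s : seq nat) : nat :=
  let l := last 0 s in head 0 [seq x <- iota l.+1 l | nreps s x == 1].

(* The first m + 2 terms of V(a, b). *)
Fixpoint Vprefix (a b m : nat) : seq nat :=
  if m is m'.+1 then let s := Vprefix a b m' in rcons s (next_term s)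
  else [:: a; b].

(* Indices start at 0: V a b m is the term written a_(m+1) when the sequence
   is numbered a_1 = a, a_2 = b, ... *)
Definition V (a b m : nat) : nat := nth 0 (Vprefix a b m) m.

Definition is_power_of_2 (x : nat) : Prop := exists k : nat, x = 2 ^ k.

(* X is a union of finitely many infinite progressions {c + k * d : k >= 0},
   each listed as a pair (c, d) with d > 0. *)
Definition finite_union_of_AP (X : nat -> Prop) : Prop :=
  exists2 ps : seq (nat * nat), all (fun p => 0 < p.2) ps &
    forall x : nat,
      X x <-> exists2 p, p \in ps & exists k : nat, x = p.1 + k * p.2.

Example V_2_3 :
  [seq V 2 3 m | m <- iota 0 9] = [:: 2; 3; 4; 5; 9; 10; 11; 16; 22].
Proof. by vm_compute. Qed.

Lemma size_Vprefix a b m : size (Vprefix a b m) = m.+2.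
Proof. by elim: m => //= m IH; rewrite size_rcons IH. Qed.

Lemma nth_Vprefix a b m i :
  i <= m.+1 -> nth 0 (Vprefix a b m) i = V a b i.
Proof.
have stepE k j : j < k.+2 ->
    nth 0 (Vprefix a b k.+1) j = nth 0 (Vprefix a b k) j.
  by move=> lt_jk; rewrite /= nth_rcons size_Vprefix lt_jk.
have addE d k j : j < k.+2 ->
    nth 0 (Vprefix a b (k + d)) j = nth 0 (Vprefix a b k) j.
  elim: d => [|d IH] lt_jk; first by rewrite addn0.
  by rewrite addnS stepE ?IH // (leq_trans lt_jk) // !ltnS leq_addr.
rewrite leq_eqVlt => /predU1P[->|lt_im]; first by rewrite /V stepE.
by rewrite -(subnKC (n := m) (m := i)) // addE.
Qed.

Lemma V0 a b : V a b 0 = a. Proof. by []. Qed.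

Lemma V1 a b : V a b 1 = b. Proof. by []. Qed.

Lemma nreps_eq1P a b m x :
  reflect (exists! p : nat * nat,
             [/\ p.1 <= p.2, p.2 <= m.+1 & V a b p.1 + V a b p.2 = x])
          (nreps (Vprefix a b m) x == 1).
Proof.
set S := Vprefix a b m.
set L := [seq (i, j) | j <- iota 0 (size S), i <- iota 0 j.+1].
have memL p : (p \in L) = (p.1 <= p.2) && (p.2 <= m.+1).
  case: p => i j; apply/allpairsPdep/andP.
    case=> j' [i' []]; rewrite !mem_iota !add0n => /andP[_ lt_j] /andP[_ lt_i].
    case=> -> -> /=; rewrite -ltnS lt_i; split=> //.
    by rewrite -ltnS -(size_Vprefix a b m).
  case=> le_ij le_jm; exists j, i.
  by rewrite !mem_iota !add0n !leq0n /= size_Vprefix !ltnS.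
have uniqL : uniq L.
  apply: allpairs_uniq_dep => [|j _|]; rewrite ?iota_uniq //.
  by move=> [j i] [j' i'] _ _ /= [-> ->].
pose P (p : nat * nat) := nth 0 S p.1 + nth 0 S p.2 == x.
have memF p : (p \in [seq p <- L | P p]) <->
    [/\ p.1 <= p.2, p.2 <= m.+1 & V a b p.1 + V a b p.2 = x].
  rewrite mem_filter memL /P; split=> [/and3P[/eqP <- le1 le2]|[le1 le2 <-]].
    by split=> //; rewrite !nth_Vprefix // (leq_trans le1).
  by rewrite le1 le2 !nth_Vprefix ?eqxx // (leq_trans le1).
have uniqF : uniq [seq p <- L | P p] by rewrite filter_uniq.
rewrite /nreps -/L -size_filter -/P.
apply: (iffP eqP).
  case EF: [seq p <- L | P p] memF => [|p [|q s]] // memF _.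
  exists p; split; first by apply/memF; rewrite mem_head.
  by move=> q /memF; rewrite inE => /eqP.
case=> p [/memF Fp pU].
case EF: [seq p <- L | P p] Fp memF uniqF => [|q [|r s]] // _ memF.
have /memF/pU <- : q \in [:: q, r & s] by rewrite mem_head.
have /memF/pU <- : r \in [:: q, r & s] by rewrite !inE eqxx orbT.
by rewrite /= inE eqxx.
Qed.

Lemma V_next a b m : V a b m.+2 = next_term (Vprefix a b m).
Proof.
by rewrite -(@nth_Vprefix a b m.+1) //= nth_rcons size_Vprefix ltnn eqxx.
Qed.

Lemma V_step_aux a b m (candidate := fun x : nat =>
    V a b m.+1 < x /\
    exists! p : nat * nat,
      [/\ p.1 <= p.2, p.2 <= m.+1 & V a b p.1 + V a b p.2 = x]) :
  (forall j, j <= m -> V a b j < V a b j.+1) ->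
  candidate (V a b m.+2) /\ (forall x, candidate x -> V a b m.+2 <= x).
Proof.
move=> inc; set l := V a b m.+1.
have lt_l d i : i + d = m -> V a b i < l.
  elim: d i => [|d IH] i; first by rewrite addn0 => ->; apply: inc.
  rewrite addnS -addSn => eq_m; apply: leq_trans (inc i _) (ltnW (IH _ eq_m)).
  by rewrite -eq_m addSn -addnS leq_addr.
have lt_V i : i <= m -> V a b i < l.
  by move=> le_im; apply: (lt_l (m - i)); rewrite subnKC.
have le_V i : i <= m.+1 -> V a b i <= l.
  by rewrite leq_eqVlt => /predU1P[->|/lt_V/ltnW].
have last_l : last 0 (Vprefix a b m) = l.
  by rewrite -nth_last size_Vprefix nth_Vprefix.
have candl : candidate (l + l).
  split; first by rewrite -addn1 leq_add2l (leq_trans _ (inc m _)).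
  exists (m.+1, m.+1); split=> // -[i j] /= [le_ij le_jm Vij].
  have le_im := leq_trans le_ij le_jm.
  have [le_im'|lt_mi] := leqP i m.
    suff: V a b i + V a b j < l + l by rewrite Vij ltnn.
    by rewrite -addSn leq_add ?lt_V ?le_V.
  have eq_i : i = m.+1 by apply/eqP; rewrite eqn_leq le_im.
  have eq_j : j = m.+1 by apply/eqP; rewrite eqn_leq le_jm -eq_i.
  by rewrite eq_i eq_j.
set F := [seq x <- iota l.+1 l | nreps (Vprefix a b m) x == 1].
have memF x : (x \in F) <-> candidate x /\ x <= l + l.
  rewrite mem_filter mem_iota addSn ltnS; split.
    by case/and3P=> /nreps_eq1P.
  by case=> [[lt_lx /nreps_eq1P ->]] ->; rewrite lt_lx.
have VF : V a b m.+2 = head 0 F by rewrite V_next /next_term last_l.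
have sortF : sorted leq F by apply: (sorted_filter leq_trans); apply: iota_sorted.
have minF x : x \in F -> head 0 F \in F /\ head 0 F <= x.
  case: F sortF {memF VF} => //= y s ys; rewrite !inE eqxx; split=> //.
  have /predU1P[->//|] : x \in y :: s by [].
  by move/allP: (order_path_min leq_trans ys) => /[apply].
have [/memF[candV _] le_V2] : head 0 F \in F /\ head 0 F <= l + l.
  by apply: minF; apply/memF.
rewrite VF; split=> // x candx.
have [le_x|/ltnW] := leqP x (l + l); last exact: leq_trans.
by have [|_] := minF x; first by apply/memF.
Qed.

Lemma V_increasing a b m : a < b -> V a b m < V a b m.+1.
Proof.
move=> lt_ab; elim/ltn_ind: m => -[|m] IH //.
by have [[]] := @V_step_aux a b m IH.
Qed.

(* The greedy recursion defining the sequence. *)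
Lemma V_step a b m (candidate := fun x : nat =>
    V a b m.+1 < x /\
    exists! p : nat * nat,
      [/\ p.1 <= p.2, p.2 <= m.+1 & V a b p.1 + V a b p.2 = x]) :
  a < b ->
  candidate (V a b m.+2) /\ (forall x, candidate x -> V a b m.+2 <= x).
Proof. by move=> lt_ab; apply: V_step_aux => j _; apply: V_increasing. Qed.

(* Main.v *)
Require Import Defs.
From mathcomp Require Import all_boot.
From mathcomp Require Import zify.

(* Put n = h + 1. As long as 2 and 2n are the only even terms, the odd terms are
   the n + 2j with s_j = 1, where s has generating function 1/(1 + t + t^n) over
   F_2, since the only possible sums are 2 + (x - 2) and 2n + (x - 2n). An even
   x = 2n + 2m, m >= 2, is then a term only if it has exactly one representation
   i + j = m with s_i = s_j = 1. Pairing the last n values s_(m-h), ..., s_m with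
   s_0 = ... = s_h = 1 shows that only one of them is 1; running the recurrence
   backwards and using s_(n+c) = c mod 2 gives a second representation unless
   that one is s_m. In that case s has period m, and
   s_i s_(m-i) = 0 must hold for 0 < i < m. For Q = 2^a, Frobenius gives
   s_(Qj) = s_j and s_(j+Qn) = s_(j+Qn-Q) + s_j. If h = Qq with q > 1 odd, then
   i = (Q+1)n, reduced modulo m, is a second representation. If h = Q, the first
   such m is h^2 + h + 1, and there the supports of s_i and s_(m-i) are
   disjoint for 0 < i < m. *)

Set Implicit Arguments.
Unset Strict Implicit.
Unset Printing Implicit Defensive.

(** * The sequence s: first values and Frobenius relations *)

(* The coefficients of 1/(1 + t + t^(h+1)) over F_2. *)
Definition trinomial_seq (h : nat) (s : nat -> bool) : Prop :=
  (forall i, i <= h -> s i) /\ forall i, s (i + h.+1) = s (i + h) (+) s i.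

(* The values at j, j - 1, ..., 0, in this order. *)
Fixpoint trinomial_state (h j : nat) : seq bool :=
  if j is j'.+1 then
    let w := trinomial_state h j' in (head false w (+) nth false w h) :: w
  else [:: true].

Lemma nth_trinomial_state h j i :
  nth false (trinomial_state h (j + i)) i = head false (trinomial_state h j).
Proof.
elim: i => [|i IH]; first by rewrite addn0 nth0.
by rewrite addnS /= IH.
Qed.

Lemma trinomial_seq_exists h :
  trinomial_seq h (fun j => head false (trinomial_state h j)).
Proof.
split=> [i|i]; last by rewrite addnS /= nth_trinomial_state.
have size_state j : size (trinomial_state h j) = j.+1 by elim: j => //= j ->.
elim: i => //= i IH lt_ih; rewrite IH; last exact: ltnW.
by rewrite nth_default // size_state.
Qed.

Lemma trinomial_ext h (s t : nat -> bool) :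
  (forall i, s (i + h.+1) = s (i + h) (+) s i) ->
  (forall i, t (i + h.+1) = t (i + h) (+) t i) ->
  (forall i, i <= h -> s i = t i) -> s =1 t.
Proof.
move=> recs rect eq_st; elim/ltn_ind=> i IH.
have [/eq_st //|lt_hi] := leqP i h.
by rewrite -(subnK lt_hi) recs rect !IH //; lia.
Qed.

(** In this range the delayed term of the recurrence lies among the initial ones, so every step
    flips the value. *)
Lemma trinomial_row1 h s c :
  trinomial_seq h s -> c <= h -> s (h.+1 + c) = odd c.
Proof.
move=> [small rec]; elim: c => [_|c IH lt_ch].
  by have := rec 0; rewrite !add0n addn0 => ->; rewrite !small.
rewrite addnC rec (_ : c.+1 + h = h.+1 + c); last by lia.
by rewrite IH ?small ?addbT // ltnW.
Qed.

Lemma trinomial_row2 h s : trinomial_seq h s -> 2 <= h -> ~~ odd h ->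
  s (h.+1 + h.+2) && s (h.+1 + h.+3).
Proof.
move=> ts h2 evh; have [small rec] := ts.
have s0 : s (h.+1 + h.+1) = false.
  rewrite rec (trinomial_row1 ts) // -[X in s X]addn0.
  by rewrite (trinomial_row1 ts) // (negbTE evh).
have s1 : s (h.+1 + h.+2).
  rewrite (_ : _ + _ = h.+1 + 1 + h.+1); last by lia.
  rewrite rec (_ : _ + h = h.+1 + h.+1); last by lia.
  by rewrite s0 (trinomial_row1 ts) //; lia.
rewrite s1 (_ : _ + _ = h.+1 + 2 + h.+1); last by lia.
rewrite rec (_ : _ + h = h.+1 + h.+2); last by lia.
by rewrite s1 (trinomial_row1 ts).
Qed.

(** With the shift E the recurrence reads E^(h+1) = E^h + 1, and raising it to the power Q = 2^a
    over F_2 gives E^(Qh+Q) = E^(Qh) + 1. The induction squares the relation: the equal cross terms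
    cancel. *)
Lemma trinomial_frobenius_rec h s a i : trinomial_seq h s ->
  s (i + 2 ^ a * h + 2 ^ a) = s (i + 2 ^ a * h) (+) s i.
Proof.
move=> [small rec]; elim: a i => [|a IH] i.
  by rewrite mul1n -addnA addn1 rec.
set Q := 2 ^ a in IH *; rewrite expnS -/Q.
have E1 : i + 2 * Q * h + 2 * Q = i + Q * h + Q + Q * h + Q by lia.
have E2 : i + Q * h + Q + Q * h = i + Q * h + Q * h + Q by lia.
have E3 : i + 2 * Q * h = i + Q * h + Q * h by lia.
by rewrite E1 IH E2 IH IH E3 addbA addbK.
Qed.

(** By Frobenius with Q = 2, [s (2 * i)] obeys the recurrence of [s i]. The initial values agree
    because, for even h, an even index past h has an odd offset in the alternating row. *)
Lemma trinomial_double h s i : trinomial_seq h s -> ~~ odd h ->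
  s (2 * i) = s i.
Proof.
move=> ts evh; have [small rec] := ts; move: i.
apply: (@trinomial_ext h) => // [i|i le_ih].
  have := trinomial_frobenius_rec 1 (2 * i) ts; rewrite expn1.
  by rewrite (_ : 2 * (i + h.+1) = 2 * i + 2 * h + 2) ?mulnDr //; lia.
rewrite (small i) //; have [/small //|lt_h] := leqP (2 * i) h.
rewrite -(subnKC lt_h) (trinomial_row1 ts); last by lia.
by rewrite oddB // oddM /= evh.
Qed.

Lemma trinomial_pow2 h s a i : trinomial_seq h s -> ~~ odd h ->
  s (2 ^ a * i) = s i.
Proof.
move=> ts evh; elim: a i => [|a IH] i; first by rewrite mul1n.
by rewrite expnS -mulnA (trinomial_double _ ts).
Qed.

(** When a one leaves the window, [s (k + h.+1)] is the negation of [s (k + h)], so one of these two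
    is a one. *)
Lemma trinomial_nonzero h s k : trinomial_seq h s -> 0 < h ->
  exists2 a, a <= h & s (k + a).
Proof.
move=> [small rec] h_gt0; elim: k => [|k [[_ sk|a lt_ah ska]]].
- by exists 0; rewrite ?small.
- rewrite addn0 in sk; have := rec k; case skh: (s (k + h)) => /= recE.
    by exists h.-1; [lia | rewrite addSn -addnS prednK].
  by exists h; rewrite // addSn -addnS recE sk.
by exists a; [exact: ltnW | rewrite addSn -addnS].
Qed.

(** * Second representations and resets *)

Definition two_pairs (s : nat -> bool) (m : nat) : Prop :=
  exists i j, [/\ i < j, j * 2 <= m, s i && s (m - i) & s j && s (m - j)].

Lemma two_pairs_intro (s : nat -> bool) m i j :
  i <= m -> j <= m -> i != j -> i != m - j ->
  s i && s (m - i) -> s j && s (m - j) -> two_pairs s m.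
Proof.
have half k : k <= m -> s k && s (m - k) ->
    let k' := minn k (m - k) in k' * 2 <= m /\ s k' && s (m - k').
  move=> le_km sk /=; have [le_k|lt_k] := leqP k (m - k); first by split=> //; lia.
  by rewrite subKn // andbC; split=> //; lia.
move=> le_im le_jm ne1 ne2 /half[] // i2 si /half[] // j2 sj.
have [lt_ij|lt_ji|] := ltngtP (minn i (m - i)) (minn j (m - j)); last by move=> ?; exfalso; lia.
  by exists (minn i (m - i)), (minn j (m - j)).
by exists (minn j (m - j)), (minn i (m - i)).
Qed.

(* A reset is a position where the window of the last h + 1 values is the
   initial window 0, ..., 0, 1 of the sequence. *)
Definition reset (h : nat) (s : nat -> bool) (m : nat) : Prop :=
  [/\ h < m, s m & forall a, 0 < a <= h -> s (m - a) = false].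

(** Up to [h.*2 - 2] all members of two pairs fit among the initial ones; the last three values of m
    also use the ones at [h.+1 + 1] and [h.+1 + 3]. *)
Lemma two_pairs_small h s m : trinomial_seq h s -> ~~ odd h -> 4 <= h ->
  2 <= m <= h.*2.+1 -> two_pairs s m.
Proof.
move=> ts evh h4 m_bd; have [small rec] := ts.
have row1 c : c <= h -> odd c -> s (h.+1 + c).
  by move=> le_ch odd_c; rewrite (trinomial_row1 ts).
have pair i j : i <= h -> j <= h -> m - j <= h -> j <= m -> i != j -> i != m - j ->
    i <= m -> s (m - i) -> two_pairs s m.
  move=> le_i le_j le_mj le_jm ne1 ne2 le_im si.
  by apply: (@two_pairs_intro s m i j); rewrite ?si ?(small i) ?(small j) ?(small (m - j)).
have [le_mh|lt_hm] := leqP m h.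
  by apply: (@pair 0 1); rewrite ?small //; lia.
have [le_m|lt_m] := leqP m (h.*2 - 2).
  by apply: (@pair h h.-1); rewrite ?small //; lia.
have [Em|ne1] := eqVneq m (h.*2 - 1).
  apply: (@pair (h - 3) h); try lia.
  by rewrite (_ : m - _ = h.+1 + 1) ?row1 //; lia.
have [Em|ne2] := eqVneq m h.*2.
  apply: (@pair (h - 2) h); try lia.
  by rewrite (_ : m - _ = h.+1 + 1) ?row1 //; lia.
apply: (@two_pairs_intro s m (h - 1) (h - 3)); try lia.
  by rewrite (_ : m - _ = h.+1 + 1) ?row1 ?small //; lia.
by rewrite (_ : m - _ = h.+1 + 3) ?row1 ?small //; lia.
Qed.

(** The partners a and b are initial ones; [h.*2 < m] puts [m - a] beyond h, so the two pairs cannot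
    coincide. *)
Lemma two_pairs_window h s m a b : trinomial_seq h s -> h.*2 < m ->
  a <= h -> b <= h -> a != b -> s (m - a) -> s (m - b) -> two_pairs s m.
Proof.
move=> [small _] lt_m le_ah le_bh ne_ab sa sb.
by apply: (@two_pairs_intro s m a b); rewrite ?sa ?sb ?small //; lia.
Qed.

(** The window from [m - h] to m always contains two of the four ones at 2h - 2, 2h, 2h + 3 and 2h +
    4. *)
Lemma two_pairs_medium h s m : trinomial_seq h s -> ~~ odd h -> 4 <= h ->
  h.*2 < m <= 3 * h.+1 -> two_pairs s m.
Proof.
move=> ts evh h4 m_bd.
have row1 c : c <= h -> odd c -> s (h.+1 + c).
  by move=> le_ch odd_c; rewrite (trinomial_row1 ts).
have /andP[row21 row22] : s (h.+1 + h.+2) && s (h.+1 + h.+3).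
  by apply: (trinomial_row2 ts); lia.
have window i j : m - h <= i -> m - h <= j -> i <= m -> j <= m -> i != j ->
    s i -> s j -> two_pairs s m.
  move=> *; apply: (@two_pairs_window h s m (m - i) (m - j)); rewrite ?subKn //; lia.
have [le_m|lt_m] := leqP m (3 * h - 2).
  by apply: (window (h.+1 + (h - 3)) (h.+1 + (h - 1))); rewrite ?row1 //; lia.
have [le_m|lt_m'] := leqP m (3 * h).
  by apply: (window (h.+1 + (h - 1)) (h.+1 + h.+2)); rewrite ?row21 ?row1 //; lia.
by apply: (window (h.+1 + h.+2) (h.+1 + h.+3)) => //; lia.
Qed.

Lemma two_pairs_or_reset h s m : trinomial_seq h s -> ~~ odd h -> 4 <= h ->
  2 <= m -> two_pairs s m \/ reset h s m.
Proof.
move=> ts evh h4 m_ge2; have [small rec] := ts.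
have [le_m|lt_m] := leqP m h.*2; first by left; apply: (two_pairs_small ts); lia.
have [le_m|lt_m'] := leqP m (3 * h.+1).
  by left; apply: (two_pairs_medium ts); rewrite ?lt_m.
have [|a le_ah sa] := @trinomial_nonzero h s (m - h) ts; first by lia.
have {a le_ah sa} [a le_ah sa] : exists2 a, a <= h & s (m - a).
  by exists (h - a); rewrite ?leq_subr // (_ : m - _ = m - h + a) //; lia.
have [/existsP[b /andP[ne_ba sb]]|] :=
    boolP [exists b : 'I_h.+1, (b != a :> nat) && s (m - b)].
  by left; apply: (two_pairs_window ts _ _ le_ah ne_ba) => //; rewrite -ltnS.
rewrite negb_exists => /forallP unit_a.
have {}unit_a b : b <= h -> b != a -> s (m - b) = false.
  move=> le_bh ne_ba; have := unit_a (Ordinal (le_bh : b < h.+1)).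
  by rewrite /= ne_ba => /negbTE.
have [a0|a_gt0] := posnP a.
  right; split; [lia | by rewrite -[m]subn0 -a0 |].
  by move=> b /andP[b_gt0 le_bh]; rewrite unit_a //; lia.
(* Running the recurrence backwards from the isolated one at [m - a] gives a one at
   [m - (h.+1 + b)]; b is taken odd so that its partner [h.+1 + b] in the alternating row is a one
   too. *)
left; pose b := if odd a then a else a.-1.
have odd_b : odd b by rewrite /b; case: ifP => //; lia.
have le_b : b <= h.-1 by rewrite /b; case: ifP; lia.
have sb : s (m - (h.+1 + b)).
  have := rec (m - (h.+1 + b)).
  rewrite (_ : _ + h.+1 = m - b); last by lia.
  rewrite (_ : _ + h = m - b.+1); last by lia.
  move: le_b; rewrite /b; case: ifP => _ le_b.
    by rewrite sa (unit_a a.+1) //; lia.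
  by rewrite prednK // sa (unit_a a.-1) ?addTb; [case: (s _) | lia..].
apply: (@two_pairs_intro s m a (h.+1 + b)); rewrite ?sa ?sb ?(small a) //=; try lia.
by rewrite (trinomial_row1 ts) ?odd_b //; lia.
Qed.

(** * Periodicity from a reset *)

(** While the zeros of the reset window are the delayed terms, the recurrence copies the one at m,
    which recreates the initial block of ones. *)
Lemma reset_period h s m : trinomial_seq h s -> reset h s m ->
  forall j, s (m + j) = s j.
Proof.
move=> [small rec] [lt_hm sm s0]; apply: (@trinomial_ext h) => // [i|i le_ih].
  by rewrite !addnA rec.
rewrite (small i) //; elim: i le_ih => [|i IH] lt_ih; first by rewrite addn0.
have := rec (m + i.+1 - h.+1).
rewrite (_ : _ + h.+1 = m + i.+1) => [->|]; last by lia.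
rewrite (_ : _ + h = m + i); last by lia.
by rewrite IH 1?ltnW // (_ : _ - _ = m - (h - i)) ?s0 //; lia.
Qed.

Lemma reset_period_mul h s m k j : trinomial_seq h s -> reset h s m ->
  s (m * k + j) = s j.
Proof.
move=> ts rm; elim: k => [|k IH]; first by rewrite muln0.
by rewrite mulnS -addnA (reset_period ts rm).
Qed.

Lemma reset_mul h s m k : trinomial_seq h s -> reset h s m -> 0 < k ->
  reset h s (m * k).
Proof.
move=> ts rm; have [lt_hm sm s0] := rm; case: k => // k _; rewrite mulnSr.
split=> [||a a_bd]; first by rewrite ltn_addl.
  by rewrite (reset_period_mul k m ts rm).
by rewrite -addnBA ?(reset_period_mul k _ ts rm) ?s0 //; lia.
Qed.

Lemma reset_back h s m : trinomial_seq h s -> 0 < h -> reset h s m ->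
  s (m - h.+1) /\ forall a, 0 < a < h -> h.+1 + a <= m ->
    s (m - (h.+1 + a)) = false.
Proof.
move=> [small rec] h_gt0 [lt_hm sm s0]; split=> [|a a_bd le_m].
  have := rec (m - h.+1); rewrite subnK // sm.
  by rewrite (_ : _ + h = m - 1) ?(s0 1) ?addFb //; lia.
have := rec (m - (h.+1 + a)).
rewrite (_ : _ + h.+1 = m - a) ?(s0 a); [|lia..].
by rewrite (_ : _ + h = m - a.+1) ?(s0 a.+1); [case: (s _)|lia..].
Qed.

(** * The case h = Qq with q > 1 odd *)

(** The first index is [2 ^ a * (h.+1 + q)], which Frobenius reduces to the odd offset q of the
    alternating row. Its one serves to show that the second index is not a multiple of a reset. *)
Lemma trinomial_two_ones h s a q : trinomial_seq h s -> ~~ odd h ->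
    h = 2 ^ a * q -> odd q ->
  s ((2 ^ a).+1 * h.+1).-1 && s ((2 ^ a).+1 * h.+1).
Proof.
move=> ts evh def_h odd_q; have [small rec] := ts.
have s1 : s ((2 ^ a).+1 * h.+1).-1.
  rewrite (_ : _.-1 = 2 ^ a * (h.+1 + q)); last by lia.
  rewrite (trinomial_pow2 _ _ ts) // (trinomial_row1 ts) //.
  by rewrite def_h leq_pmull // expn_gt0.
have s2 : s (2 ^ a * h.+1) = false.
  rewrite (trinomial_pow2 _ _ ts) // -[X in s X]addn0.
  by rewrite (trinomial_row1 ts).
rewrite s1 mulSnr rec s2 addbF -[X in s X]/(_.+1.-1) -addnS.
by rewrite -mulSnr.
Qed.

Lemma reset_two_pairs h s m a q : trinomial_seq h s -> ~~ odd h -> 0 < h ->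
  h = 2 ^ a * q -> odd q -> 1 < q -> reset h s m -> two_pairs s m.
Proof.
move=> ts evh h_gt0 def_h odd_q q_gt1 rm; have [small rec] := ts.
have [lt_hm sm s0] := rm.
have /andP[] := trinomial_two_ones ts evh def_h odd_q.
set Q := 2 ^ a in def_h *; set i := Q.+1 * h.+1 => si1 si.
have Q_gt0 : 0 < Q by rewrite expn_gt0.
have lt_Qh : Q < h by rewrite def_h ltn_Pmulr.
have i_gt0 : 0 < i by rewrite muln_gt0.
(* The multiple [m * i] of the period is large enough for [m * i - i] to stand for -i modulo m. *)
have le_iM : i <= m * i by rewrite leq_pmull // (leq_trans _ lt_hm).
have [sM1 sM0] := reset_back ts h_gt0 (reset_mul ts rm i_gt0).
(* Frobenius expresses this value through those at [m * i - h.+1] and [m * i - (h.+1 + Q)]: a one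
   and, since [Q < h], a zero. *)
have sMi : s (m * i - i).
  have := trinomial_frobenius_rec a (m * i - i) ts; rewrite -/Q.
  have E : i = Q * h + Q + h.+1 by rewrite /i; lia.
  rewrite (_ : _ + Q = m * i - h.+1); last by lia.
  rewrite (_ : _ + Q * h = m * i - (h.+1 + Q)); last by lia.
  by rewrite sM1 sM0 //; lia.
have def_i : i = m * (i %/ m) + i %% m by rewrite {1}(divn_eq i m) mulnC.
have lt_im : i %% m < m by rewrite ltn_mod; lia.
have lt_div : i %/ m < i by rewrite ltn_Pdiv //; lia.
(* If m divided i, then [i.-1] would be -1 modulo m and carry a zero, against [si1]. *)
have im_gt0 : 0 < i %% m.
  rewrite lt0n; apply/eqP => im0; move: si1; rewrite def_i im0 addn0.
  case: (i %/ m) def_i => [|d] def_i; first by lia.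
  rewrite mulnSr (_ : (_ + m).-1 = m * d + (m - 1)); last by lia.
  by rewrite (reset_period_mul d _ ts rm) s0.
have sim : s (i %% m) by rewrite -(reset_period_mul (i %/ m) _ ts rm) -def_i.
have smim : s (m - i %% m).
  rewrite -(reset_period_mul (i - (i %/ m).+1) _ ts rm).
  have -> // : m * (i - (i %/ m).+1) + (m - i %% m) = m * i - i.
  have : m * i = m * (i - (i %/ m).+1) + (m * (i %/ m) + m).
    by rewrite -mulnSr -mulnDr subnK.
  clear -def_i lt_im; move: (m * i) (m * (i - _)) def_i => u v.
  by move: (m * (i %/ m)) (i %% m) lt_im => w r; lia.
apply: (@two_pairs_intro s m 0 (i %% m)); rewrite ?subn0 ?sm ?sim ?smim ?small //;
  by move: im_gt0 lt_im; clear; move: (i %% m) => r; lia.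
Qed.

(** * The case of h a power of 2 *)

(** Frobenius puts a one at each [h * k]. Two such ones cancel at [h * k + 1], and each further zero
    comes from its left neighbour and a zero of the previous row, so the block of zeros grows by one
    per row. *)
Lemma trinomial_pow2_zeros h s a k j : trinomial_seq h s -> ~~ odd h ->
  h = 2 ^ a -> 0 < j <= k -> k <= h -> s (h * k + j) = false.
Proof.
move=> ts evh def_h; have [small rec] := ts.
have s1 i : i <= h -> s (h * i).
  by move=> le_ih; rewrite def_h (trinomial_pow2 _ _ ts) ?small.
elim: k j => [|k IHk] j; first by lia.
move=> j_bd lt_kh; elim: j j_bd => // -[|j] IHj j_bd.
  by rewrite mulnSr -addnA addn1 rec -mulnSr !s1 // ltnW.
rewrite mulnSr (_ : _ + _ + _ = h * k + j.+1 + h.+1); last by lia.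
rewrite rec IHk; [|lia..].
by rewrite (_ : _ + h = h * k.+1 + j.+1) ?IHj; lia.
Qed.

Lemma reset_pow2 h s a : trinomial_seq h s -> ~~ odd h -> h = 2 ^ a ->
  reset h s (h * h + h.+1).
Proof.
move=> ts evh def_h; have [small rec] := ts.
have zeros := trinomial_pow2_zeros ts evh def_h.
have h_gt0 : 0 < h by rewrite def_h expn_gt0.
split=> [||b b_bd]; first by rewrite ltn_addl.
  by rewrite rec zeros ?h_gt0 //= {1}def_h (trinomial_pow2 _ _ ts) ?small.
by rewrite -addnBA ?zeros //; lia.
Qed.

(** The h zeros before a reset cover a multiple of h, but all multiples of h up to [h * h] carry
    ones. *)
Lemma reset_pow2_min h s a m : trinomial_seq h s -> ~~ odd h -> h = 2 ^ a ->
  reset h s m -> h * h + h < m.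
Proof.
move=> ts evh def_h [lt_hm sm s0]; have [small rec] := ts.
rewrite ltnNge; apply/negP => le_m.
have h_gt0 : 0 < h by rewrite def_h expn_gt0.
have def_m : m.-1 = h * (m.-1 %/ h) + m.-1 %% h by rewrite {1}(divn_eq m.-1 h) mulnC.
have lt_mod : m.-1 %% h < h by rewrite ltn_mod.
have le_div : m.-1 %/ h <= h by rewrite -ltnS ltn_divLR //; lia.
have : s (h * (m.-1 %/ h)) by rewrite {1}def_h (trinomial_pow2 _ _ ts) ?small.
rewrite (_ : h * _ = m - (m.-1 %% h).+1) ?s0 //.
by move: def_m lt_hm; clear; move: (h * _) (m.-1 %% h) => u v; lia.
Qed.

(** Going back from m, a one at distance i stems from a one at distance [i - h] or [i - h.+1], so k
    steps lead between [h * k] and [h * k + k]. The lower bound is strict because distance h carries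
    a zero, which forces the first step to be [h.+1]. *)
Lemma reset_support h s m i : trinomial_seq h s -> 0 < h -> reset h s m -> i <= m ->
  s (m - i) -> i = 0 \/ exists k, h * k < i <= h * k + k.
Proof.
move=> [small rec] h_gt0 [lt_hm sm s0]; elim/ltn_ind: i => i IH le_im si.
have [->|i_gt0] := posnP i; first by left.
have [le_ih|lt_hi] := leqP i h; first by rewrite s0 ?i_gt0 in si.
right; have := rec (m - i); rewrite si addbT.
rewrite (_ : _ + h.+1 = m - (i - h.+1)); last by lia.
rewrite (_ : _ + h = m - (i - h)); last by lia.
case s1: (s (m - (i - h))) => s2.
  have [|||[k k_bd]] := IH _ _ _ s1; [lia..|].
  by exists k.+1; rewrite mulnS; lia.
have [|||[k k_bd]] := IH _ _ _ s2; [lia|lia|exists 1; lia|].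
by exists k.+1; rewrite mulnS; lia.
Qed.

(** For [k <= h] the intervals of [reset_support] are exactly the blocks where
    [trinomial_pow2_zeros] makes s vanish; [k > h] forces i = m. *)
Lemma pow2_unique_pair h s a i (m := h * h + h.+1) :
  trinomial_seq h s -> ~~ odd h -> h = 2 ^ a ->
  i <= m -> s i -> s (m - i) -> i = 0 \/ i = m.
Proof.
move=> ts evh def_h le_im si smi.
have h_gt0 : 0 < h by rewrite def_h expn_gt0.
have [->|[k k_bd]] := reset_support ts h_gt0 (reset_pow2 ts evh def_h) le_im smi.
  by left.
right; have [le_kh|lt_hk] := leqP k h; last by move: le_im; rewrite /m; nia.
have : s (h * k + (i - h * k)) = false.
  by apply: (trinomial_pow2_zeros ts evh def_h) => //; lia.
by rewrite subnKC ?si //; lia.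
Qed.

(** * Membership in V(a, b) as a condition on values *)

Definition term (a b x : nat) : Prop := exists m, V a b m = x.

Definition unique_sum (T : nat -> Prop) (x : nat) : Prop :=
  exists! p : nat * nat, [/\ p.1 <= p.2, T p.1, T p.2 & p.1 + p.2 = x].

Lemma V_lt a b : a < b -> {homo V a b : i j / i < j}.
Proof. by move=> lt_ab; apply: (homo_ltn ltn_trans) => i; apply: V_increasing. Qed.

Lemma V_le a b : a < b -> {mono V a b : i j / i <= j}.
Proof. by move=> lt_ab; apply: leq_mono; apply: V_lt. Qed.

Lemma V_inj a b : a < b -> injective (V a b).
Proof.
by move=> lt_ab i j eqV; apply/eqP; rewrite eqn_leq -(V_le lt_ab i j) -(V_le lt_ab j i) eqV leqnn.
Qed.

Lemma V_gt0 a b k : 0 < a < b -> 0 < V a b k.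
Proof.
case/andP=> a_gt0 lt_ab; case: k => // k.
exact: leq_ltn_trans (V_increasing k lt_ab).
Qed.

(** Terms are positive, so both summands of x lie below x, among the terms preceding the first one
    that is at least x; the greedy choice at that index tests x. *)
Lemma term_rec a b x : 0 < a < b -> b < x ->
  term a b x <-> unique_sum (term a b) x.
Proof.
move=> /andP[a_gt0 lt_ab] lt_bx.
have V_ge k : k <= V a b k.
  by elim: k => // k IH; apply: leq_ltn_trans IH (V_increasing k lt_ab).
have Vk_gt0 k : 0 < V a b k by apply: V_gt0; rewrite a_gt0.
have [m lt_mx le_xm] : exists2 m, V a b m.+1 < x & x <= V a b m.+2.
  have [k le_xk min_k] := ex_minnP (ex_intro (fun k => x <= V a b k) x (V_ge x)).
  case: k le_xk min_k => [|[|m]] le_xk min_k.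
  - by move: le_xk; rewrite V0; lia.
  - by move: le_xk; rewrite V1; lia.
  by exists m => //; rewrite ltnNge; apply/negP => /min_k; rewrite ltnn.
have idx i : V a b i < x -> i <= m.+1.
  move=> lt_ix; rewrite leqNgt; apply/negP => lt_mi.
  by move: (leq_trans lt_ix le_xm); rewrite ltnNge (V_le lt_ab) lt_mi.
have [[_ candV] minV] := V_step m lt_ab.
have sumE : (exists! p : nat * nat,
      [/\ p.1 <= p.2, p.2 <= m.+1 & V a b p.1 + V a b p.2 = x])
    <-> unique_sum (term a b) x.
  split=> [[[i j] /= [[le_ij le_jm Vij] uniq_ij]]|].
    exists (V a b i, V a b j); split=> /=.
      by split; rewrite ?(V_le lt_ab) //; [exists i | exists j].
    case=> u v /= [le_V [i' Vi] [j' Vj] eqx]; subst u v.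
    suff [-> ->] : (i, j) = (i', j') by [].
    apply: uniq_ij; rewrite -(V_le lt_ab); split=> //; apply: idx.
    by rewrite -eqx -[X in X < _]add0n ltn_add2r.
  case=> -[u v] [[/= le_V [i /= Vi] [j /= Vj] /= eqx] uniq_V]; subst u v; rewrite (V_le lt_ab) in le_V.
  exists (i, j); split=> /=.
    by split=> //; apply: idx; rewrite -eqx -[X in X < _]add0n ltn_add2r.
  case=> i' j' /= [le_ij' _ eqx'].
  suff [/(V_inj lt_ab) -> /(V_inj lt_ab) ->] :
    (V a b i, V a b j) = (V a b i', V a b j') by [].
  by apply: uniq_V; split=> //=; rewrite ?(V_le lt_ab) //; [exists i' | exists j'].
split=> [[k Vk]|/sumE candx].
  apply/sumE; move: candV; suff -> : V a b m.+2 = x by [].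
  have lt_mk : m.+1 < k by rewrite ltnNge -(V_le lt_ab) Vk -ltnNge.
  by apply/eqP; rewrite eqn_leq le_xm -Vk (V_le lt_ab) lt_mk.
by exists m.+2; apply/eqP; rewrite eqn_leq le_xm minV.
Qed.

(** * The candidate set and its unique sums *)

(* The odd terms are n + 2 * j with s j, where n = h + 1. *)
Definition term_form (h : nat) (s : nat -> bool) (x : nat) : bool :=
  [|| x == 2, x == 2 * h.+1 | [&& odd x, h.+1 <= x & s ((x - h.+1)./2)]].

Lemma term_form_odd h s j : ~~ odd h -> term_form h s (h.+1 + 2 * j) = s j.
Proof.
move=> evh; rewrite /term_form (_ : _ - _ = j.*2); last by lia.
by rewrite doubleK; case: (s j); lia.
Qed.

Lemma term_formP h (s : nat -> bool) x : ~~ odd h ->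
  reflect [\/ x = 2, x = 2 * h.+1 | exists2 j, s j & x = h.+1 + 2 * j] (term_form h s x).
Proof.
move=> evh; apply: (iffP or3P) => [[/eqP ->|/eqP ->|/and3P[odd_x le_x sx]]|].
- exact: Or31.
- exact: Or32.
- by apply: Or33; exists (x - h.+1)./2 => //; lia.
case=> [->|->|[j sj ->]]; [exact: Or31 | exact: Or32 | apply: Or33].
by rewrite (_ : _ - _ = j.*2) ?doubleK ?sj; lia.
Qed.

(** Positive summands are below x, so only members below x matter; this feeds the strong induction
    on x. *)
Lemma unique_sum_ext (T U : nat -> Prop) x :
    (forall y, T y -> 0 < y) -> (forall y, U y -> 0 < y) ->
    (forall y, y < x -> T y <-> U y) ->
  unique_sum T x <-> unique_sum U x.
Proof.
move=> T_gt0 U_gt0 TU.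
have sumE p : [/\ p.1 <= p.2, T p.1, T p.2 & p.1 + p.2 = x] <->
    [/\ p.1 <= p.2, U p.1, U p.2 & p.1 + p.2 = x].
  split=> -[le_p p1 p2 eqx]; split=> //; apply/TU; rewrite // -eqx.
  - by rewrite -[X in X < _]addn0 ltn_add2l T_gt0.
  - by rewrite -[X in X < _]add0n ltn_add2r T_gt0.
  - by rewrite -[X in X < _]addn0 ltn_add2l U_gt0.
  - by rewrite -[X in X < _]add0n ltn_add2r U_gt0.
split=> -[p [/sumE Rp uniq_p]]; exists p; split=> // q /sumE; exact: uniq_p.
Qed.

Lemma term_form_rec_odd h s j : trinomial_seq h s -> ~~ odd h -> 2 < h ->
  s j.+1 <-> unique_sum (fun y => term_form h s y) (h.+1 + 2 * j.+1).
Proof.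
move=> [small rec] evh h2; set x := h.+1 + _; set n := h.+1.
pose A := (2, n + 2 * j).
(* [x - 2 * n] can lie on either side of [2 * n], hence the sorting. *)
pose B := (minn (2 * n) (x - 2 * n), maxn (2 * n) (x - 2 * n)).
(* Without the guard, truncated subtraction would read [s 0], which is a one. *)
pose b := (h <= j) && s (j - h).
have sE : s j.+1 = s j (+) b.
  rewrite /b; have [le_hj|lt_jh] := leqP h j.
    by have := rec (j - h); rewrite addnS subnK.
  by rewrite (small j.+1) // (small j) // ltnW.
have repE p : [/\ p.1 <= p.2, term_form h s p.1, term_form h s p.2 & p.1 + p.2 = x] <->
    (p = A /\ s j) \/ (p = B /\ b).
  split.
    case: p => u v /= [le_uv /(term_formP _ _ evh) gu /(term_formP _ _ evh) gv eqx].
    have odd_case w j' : s j' -> w = n + 2 * j' -> w + 2 * n = x -> b.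
      move=> sj' -> eqx'; rewrite /b (_ : j - h = j') ?sj'; lia.
    case: gu gv => [?|?|[i si ?]] [?|?|[k sk ?]]; try by lia.
    - by left; split; [congr (_, _); lia | rewrite (_ : j = k) //; lia].
    - by right; split; [rewrite /B; congr (_, _); lia | apply: (odd_case v k) => //; lia].
    - by right; split; [rewrite /B; congr (_, _); lia | apply: (odd_case u i) => //; lia].
  case=> [[-> sj]|[-> /andP[le_hj sj]]] /=.
    by split; rewrite ?term_form_odd //; lia.
  have sB : term_form h s (x - 2 * n).
    by rewrite (_ : x - _ = h.+1 + 2 * (j - h)) ?term_form_odd //; lia.
  have sn : term_form h s (2 * n) by rewrite /term_form eqxx orbT.
  by split; rewrite /minn /maxn; try case: ifP => ?; rewrite ?sn ?sB //; lia.
have neAB : B <> A by case; lia.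
rewrite sE; split.
  case sj: (s j) repE => repE bE.
    exists A; split; first by apply/repE; left.
    by move=> p /repE[[]//|[_ b_true]]; rewrite b_true in bE.
  exists B; split; first by apply/repE; right.
  by move=> p /repE[[]|[]].
case=> p [/repE Rp uniq_p]; case sj: (s j); case bE: b => //.
  have pA : p = A by apply: uniq_p; apply/repE; left.
  have pB : p = B by apply: uniq_p; apply/repE; right.
  by case: neAB; rewrite -pA -pB.
by case: Rp => -[_]; rewrite ?sj ?bE.
Qed.

Lemma term_form_rec_even h s m : trinomial_seq h s -> ~~ odd h -> 2 < h ->
  two_pairs s m -> ~ unique_sum (fun y => term_form h s y) (2 * h.+1 + 2 * m).
Proof.
move=> ts evh h2 [i [j [lt_ij le_jm /andP[si si'] /andP[sj sj']]]] [p [_ uniq_p]].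
have pi : p = (h.+1 + 2 * i, h.+1 + 2 * (m - i)).
  by apply: uniq_p; split; rewrite /= ?term_form_odd //; lia.
have pj : p = (h.+1 + 2 * j, h.+1 + 2 * (m - j)).
  by apply: uniq_p; split; rewrite /= ?term_form_odd //; lia.
by move: pj; rewrite pi => -[]; lia.
Qed.

Lemma term_form_even_sum h (s : nat -> bool) u v : ~~ odd h ->
    u <= v -> ~~ odd (u + v) -> h.+1 < u + v -> 2 < h -> term_form h s u -> term_form h s v ->
  [\/ (u, v) = (2, 2 * h.+1), (u, v) = (2 * h.+1, 2 * h.+1) |
      exists i j, [/\ s i, s j, u = h.+1 + 2 * i & v = h.+1 + 2 * j]].
Proof.
move=> evh le_uv ev_uv lt_h h2 /(term_formP _ _ evh) gu /(term_formP _ _ evh) gv.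
case: gu gv => [Eu|Eu|[i si Eu]] [Ev|Ev|[j sj Ev]]; subst u v; try by lia.
- exact: Or31.
- exact: Or32.
by apply: Or33; exists i, j.
Qed.

Lemma term_form_rec_even_low h s y : ~~ odd h -> 2 < h -> h.+1 < 2 * y < 2 * h.+1 ->
  ~ unique_sum (fun x => term_form h s x) (2 * y).
Proof.
move=> evh h2 y_bd [[u v] [[/= le_uv su sv eqy] _]].
by have [||[]|[]|[i [j []]]] := term_form_even_sum evh le_uv _ _ h2 su sv; lia.
Qed.

Lemma term_form_rec_even_double h s : trinomial_seq h s -> ~~ odd h -> 2 < h ->
  unique_sum (fun x => term_form h s x) (2 * h.+1).
Proof.
move=> [small rec] evh h2; have sn : term_form h s h.+1.
  by rewrite -[h.+1]addn0 -(muln0 2) term_form_odd ?small.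
exists (h.+1, h.+1); split=> [|[u v] [/= le_uv su sv eqx]].
  by split; rewrite //=; lia.
have [||[Eu Ev]|[Eu Ev]|[i [j [_ _ Eu Ev]]]] := term_form_even_sum evh le_uv _ _ h2 su sv;
  try by lia.
by congr (_, _); lia.
Qed.

Lemma term_form_rec_even_next h s : trinomial_seq h s -> ~~ odd h -> 2 < h ->
  ~ unique_sum (fun x => term_form h s x) (2 * h.+1 + 2).
Proof.
move=> [small rec] evh h2 [p [_ uniq_p]].
have pi : p = (2, 2 * h.+1).
  by apply: uniq_p; split=> /=; rewrite ?/term_form ?eqxx ?orbT //; lia.
have pj : p = (h.+1 + 2 * 0, h.+1 + 2 * 1).
  by apply: uniq_p; split; rewrite /= ?term_form_odd ?small //; lia.
by move: pj; rewrite pi => -[]; lia.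
Qed.

Lemma term_form_rec h s x : trinomial_seq h s -> ~~ odd h -> 2 < h -> h.+1 < x ->
    (forall m, 2 <= m -> x = 2 * h.+1 + 2 * m -> two_pairs s m) ->
  term_form h s x <-> unique_sum (fun y => term_form h s y) x.
Proof.
move=> ts evh h2 lt_hx pairs_x.
have [odd_x|ev_x] := boolP (odd x).
  have -> : x = h.+1 + 2 * (((x - h.+1)./2).-1).+1 by lia.
  by rewrite term_form_odd //; apply: term_form_rec_odd.
have [Ex|ne_x] := eqVneq x (2 * h.+1).
  by rewrite Ex /term_form eqxx orbT; split=> // _; apply: term_form_rec_even_double.
have -> : term_form h s x = false by rewrite /term_form; lia.
split=> // usx; exfalso; move: usx.
have [lt_x|le_x] := ltnP x (2 * h.+1).
  by rewrite (_ : x = 2 * x./2); [apply: term_form_rec_even_low; lia | lia].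
have [Ex|ne_x2] := eqVneq x (2 * h.+1 + 2).
  by rewrite Ex; apply: term_form_rec_even_next.
have Ex : x = 2 * h.+1 + 2 * (x - 2 * h.+1)./2 by lia.
by rewrite Ex; apply: term_form_rec_even => //; apply: pairs_x; lia.
Qed.

(** The bound [h.+1 < m] rules out 2 + 2n and 2n + 2n, which belong to m = 1 and m = n; only sums of
    two odd terms remain. *)
Lemma unique_sum_even h (s : nat -> bool) m : ~~ odd h -> 2 < h -> h.+1 < m ->
    s 0 -> s m -> (forall i, i <= m -> s i -> s (m - i) -> i = 0 \/ i = m) ->
  unique_sum (fun y => term_form h s y) (2 * h.+1 + 2 * m).
Proof.
move=> evh h2 lt_hm s0 sm uniq_m.
exists (h.+1 + 2 * 0, h.+1 + 2 * m); split=> [|[u v] [/= le_uv su sv eqx]].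
  by split; rewrite /= ?term_form_odd //; lia.
have [||[Eu Ev]|[Eu Ev]|[i [j [si sj Eu Ev]]]] := term_form_even_sum evh le_uv _ _ h2 su sv;
  try by lia.
have Ej : j = m - i by lia.
rewrite Ej in sj; have [|i0|im] := uniq_m i _ si sj; first by lia.
  by congr (_, _); lia.
by exfalso; lia.
Qed.

(** Both sets obey the same recursion above n as long as second representations exist. The bound B
    lets the power-of-2 case stop at the next even term. *)
Lemma term_formE h s B : trinomial_seq h s -> ~~ odd h -> 2 < h ->
    (forall m, 2 <= m -> 2 * h.+1 + 2 * m < B -> two_pairs s m) ->
  forall x, x < B -> term 2 h.+1 x <-> term_form h s x.
Proof.
move=> ts evh h2 pairs_B; have [small _] := ts; elim/ltn_ind=> x IH lt_xB.
have lt2h : 2 < h.+1 by apply: ltnW.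
have [le_x|lt_x] := leqP x h.+1.
  split=> [[m]|/(term_formP _ _ evh) gx].
    case: m => [|[|m]] => [<-|<-|Vx]; first by rewrite V0 /term_form eqxx.
      by rewrite V1 -[h.+1]addn0 -(muln0 2) term_form_odd ?small.
    by have := V_lt lt2h (isT : 1 < m.+2); rewrite V1 Vx; lia.
  case: gx => [->|Ex|[j _ Ex]]; [by exists 0 | by lia |].
  by exists 1; rewrite V1; lia.
have pairs_x m : 2 <= m -> x = 2 * h.+1 + 2 * m -> two_pairs s m.
  by move=> m2 Ex; apply: pairs_B; rewrite // -Ex.
rewrite (term_form_rec ts evh h2 lt_x pairs_x) term_rec ?lt2h //.
apply: unique_sum_ext => [_ [m <-]|y|y lt_yx]; first by apply: V_gt0.
  by rewrite /term_form; case: y; lia.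
by apply: IH => //; apply: ltn_trans lt_xB.
Qed.

(** * Eventual periodicity and arithmetic progressions *)

(** Pigeonhole on the finitely many windows of length [h.+1]; a repeated window repeats all that
    follows it. *)
Lemma trinomial_eventually_periodic h s : trinomial_seq h s ->
  exists i d, 0 < d /\ forall j, i <= j -> s (j + d) = s j.
Proof.
move=> [small rec]; pose N := #|{: {ffun 'I_h.+1 -> bool}}|.
pose w (i : 'I_N.+1) : {ffun 'I_h.+1 -> bool} := [ffun c : 'I_h.+1 => s (i + c)].
have /injectivePn[x [y ne_xy eq_w]] : ~~ injectiveb w.
  by apply/negP => /injectiveP/leq_card; rewrite card_ord ltnn.
wlog lt_xy : x y ne_xy eq_w / x < y.
  move=> wl; have [lt_xy|lt_yx|/val_inj eq_xy] := ltngtP x y; first exact: (wl x y).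
    by apply: (wl y x); rewrite // eq_sym.
  by rewrite eq_xy eqxx in ne_xy.
exists x, (y - x); split=> [|j le_xj]; first by rewrite subn_gt0.
have sxy k : s (y + k) = s (x + k).
  move: k; apply: (@trinomial_ext h) => [k|k|k le_kh]; rewrite ?addnA ?rec //.
  by have /ffunP/(_ (Ordinal (le_kh : k < h.+1))) := esym eq_w; rewrite !ffunE.
by rewrite -{2}(subnKC le_xj) -sxy; congr s; lia.
Qed.

Lemma periodic_finite_union_of_AP (s : nat -> bool) c i d :
    0 < d -> (forall j, i <= j -> s (j + d) = s j) ->
  finite_union_of_AP (fun x => exists2 j, i <= j & s j /\ x = c + 2 * j).
Proof.
move=> d_gt0 per.
have per_mul j k : i <= j -> s (j + k * d) = s j.
  move=> le_ij; elim: k => [|k IH]; first by rewrite addn0.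
  by rewrite mulSnr addnA per // (leq_trans le_ij) // leq_addr.
exists [seq (c + 2 * j, 2 * d) | j <- [seq j <- iota i d | s j]].
  by apply/allP => _ /mapP[j _ ->] /=; rewrite muln_gt0.
move=> x; split=> [[j le_ij [sj ->]]|[_ /mapP[j + ->] [k ->]]] /=.
  pose r := i + (j - i) %% d.
  have def_j : j = r + (j - i) %/ d * d.
    by rewrite /r -addnA [_ %% _ + _]addnC -divn_eq subnKC.
  exists (c + 2 * r, 2 * d) => /=.
    apply: map_f; rewrite mem_filter mem_iota /r leq_addr ltn_add2l ltn_mod d_gt0.
    by rewrite -(per_mul _ ((j - i) %/ d)) ?leq_addr // -def_j sj.
  by exists ((j - i) %/ d); rewrite {1}def_j; lia.
rewrite mem_filter mem_iota => /and3P[sj le_ij _].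
exists (j + k * d); first by rewrite (leq_trans le_ij) ?leq_addr.
by rewrite per_mul //; split=> //; lia.
Qed.

Lemma regular_of_term_formE h s : trinomial_seq h s -> ~~ odd h -> 2 < h ->
    (forall x, term 2 h.+1 x <-> term_form h s x) ->
  exists m0, finite_union_of_AP (fun x => exists2 m, m0 <= m & V 2 h.+1 m = x).
Proof.
move=> ts evh h2 termE.
have [i [d [d_gt0 per]]] := trinomial_eventually_periodic ts.
have lt2h : 2 < h.+1 by apply: ltnW.
(* Starting from [i + h.+1] puts the odd term [h.+1 + 2 * j0] above [2 * h.+1], so the tail has no
   even term. *)
have [a _ sa] := trinomial_nonzero (i + h.+1) ts (ltnW (ltnW h2)).
set j0 := i + h.+1 + a in sa.
have [m0 Vm0] : term 2 h.+1 (h.+1 + 2 * j0) by apply/termE; rewrite term_form_odd.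
have per0 j : j0 <= j -> s (j + d) = s j.
  by move=> le_j; apply: per; apply: leq_trans le_j; rewrite /j0 -addnA leq_addr.
have [ps ps_gt0 psE] := periodic_finite_union_of_AP h.+1 d_gt0 per0.
exists m0, ps => // x; rewrite -psE; split=> [[m le_m Vm]|[j le_j [sj ->]]].
  have le_x : h.+1 + 2 * j0 <= x by rewrite -Vm -Vm0 V_le.
  have /termE/(term_formP _ _ evh)[Ex|Ex|[j sj Ex]] : term 2 h.+1 x by exists m.
  - by move: le_x; rewrite Ex; lia.
  - by move: le_x; rewrite Ex /j0; lia.
  by exists j => //; move: le_x; rewrite Ex; lia.
have [m Vm] : term 2 h.+1 (h.+1 + 2 * j) by apply/termE; rewrite term_form_odd.
by exists m; rewrite // -(V_le lt2h) Vm Vm0; lia.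
Qed.

Lemma odd_part h : 0 < h -> exists a q, h = 2 ^ a * q /\ odd q.
Proof.
move=> h_gt0; have [q co_q ->] := pfactor_coprime (isT : prime 2) h_gt0.
by exists (logn 2 h), q; rewrite mulnC -coprime2n.
Qed.

Theorem theorem1p1 (n : nat) (n_ge5 : 5 <= n) (n_odd : odd n) :
  (~ is_power_of_2 (n - 1) ->
     (forall x : nat,
        (~~ odd x /\ exists m : nat, V 2 n m = x) <-> (x = 2 \/ x = 2 * n)) /\
     (exists m0 : nat,
        finite_union_of_AP (fun x : nat => exists2 m, m0 <= m & V 2 n m = x)))
  /\
  (is_power_of_2 (n - 1) ->
     forall x : nat, x \in [:: 2; 2 * n; 2 * n ^ 2 + 2] ->
       ~~ odd x /\ exists m : nat, V 2 n m = x).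
Proof.
case: n n_ge5 n_odd => // h h4 evh; rewrite subn1 [h.+1.-1]/=; rewrite /= in evh.
have h2 : 2 < h by apply: ltnW.
have ts := trinomial_seq_exists h; move: (fun _ => _) ts => s ts.
split=> [not_pow|[a def_h] x].
  have [a [q [def_h odd_q]]] := odd_part (ltnW (ltnW h2)).
  have q_gt1 : 1 < q.
    case: q odd_q def_h => [|[|q]] // _ def_h.
    by case: not_pow; exists a; rewrite def_h muln1.
  have pairs m : 2 <= m -> two_pairs s m.
    move=> m2; have [//|rm] := two_pairs_or_reset ts evh h4 m2.
    exact: reset_two_pairs ts evh (ltnW (ltnW h2)) def_h odd_q q_gt1 rm.
  have termE x : term 2 h.+1 x <-> term_form h s x.
    by apply: (@term_formE h s x.+1) => // m m2 _; apply: pairs.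
  split; last exact: regular_of_term_formE termE.
  move=> x; split=> [[ev_x /termE/(term_formP _ _ evh)[->|->|[j _ Ex]]]|].
  - by left.
  - by right.
  - by move: ev_x; rewrite Ex; lia.
  case=> ->; split; rewrite ?oddM //; apply/termE; first by rewrite /term_form eqxx.
  by rewrite /term_form eqxx orbT.
(* P is the first reset of s, so every m from 2 up to [P - 1] has two pairs. *)
set P := h * h + h.+1; have lt_hP : h.+1 < P by rewrite /P; nia.
have EB : 2 * h.+1 ^ 2 + 2 = 2 * h.+1 + 2 * P by rewrite /P; nia.
have lt2h : 2 < h.+1 by apply: ltnW.
have termE := @term_formE h s (2 * h.+1 + 2 * P) ts evh h2.
have {}termE y : y < 2 * h.+1 + 2 * P -> term 2 h.+1 y <-> term_form h s y.
  apply: termE => m m2 lt_mP; have [//|rm] := two_pairs_or_reset ts evh h4 m2.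
  by have := reset_pow2_min ts evh def_h rm; lia.
have sP : s P by have [] := reset_pow2 ts evh def_h.
rewrite !inE EB => /or3P[]/eqP->; (split; first by rewrite -?mulnDr ?mul2n ?odd_double).
- by exists 0.
- by apply/termE; [lia | rewrite /term_form eqxx orbT].
(* [termE] stops just short of 2n^2 + 2, but the sums involve only smaller terms. *)
apply/(@term_rec 2 h.+1); [by rewrite lt2h | by lia |].
apply/(@unique_sum_ext _ (fun y => term_form h s y)) => [_ [m <-]|y|y lt_y|].
- exact: V_gt0.
- by rewrite /term_form; case: y; lia.
- exact: termE.
apply: unique_sum_even => //; first by have [small _] := ts; apply: small.
by move=> i le_iP si sPi; apply: (pow2_unique_pair ts evh def_h).
Qed.
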